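(* For every positive integer $n$, there is a protocol by which $3$ agents in the synchronous model explore the infinite $n$-dimensional oriented grid, i.e., every cell of $\mathbb{Z}^n$ is eventually visited by some agent. Likewise, for every positive integer $n$, there is a protocol by which $4$ agents in the semi-synchronous model explore the infinite $n$-dimensional oriented grid.
   Context: The $n$-dimensional grid has vertex set (cells) $\mathbb{Z}^n$; two cells are adjacent if they differ by exactly $1$ in exactly one coordinate. The grid is oriented: from each cell an agent can move in any of the $2n$ global directions $(\pm 1, i)$, $i\in\{1,\dots,n\}$ (changing coordinate $i$ by $\pm 1$), or stay. There are $m$ agents, all initially in the same cell (the origin); agents cannot distinguish cells. Each agent is governed by the same deterministic finite automaton (with a finite state set $Q$), though agents may start in different initial states. The transition function has the form $\delta: Q\times 2^Q \to Q\times(\{-1,+1\}\times\{0,1,\dots,n\})$: an agent in state $q$ observes the set of states of agents currently occupying its cell and moves to a new state and to the neighboring cell in the chosen direction (dimension $0$ meaning stay). Time proceeds in discrete steps; in each step each active agent performs an atomic look-compute-move cycle. In the synchronous model all agents are active in every step; in the semi-synchronous model an adversary (knowing everything about the agents) chooses in each step an arbitrary subset of agents to be active, subject only to each agent being active infinitely often. The grid is explored if every cell is eventually visited by some agent (the protocol must achieve this for every admissible schedule in the semi-synchronous model). *)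

(* Defs.v *)
From mathcomp Require Import all_boot all_order all_algebra.
Set Implicit Arguments. Unset Strict Implicit. Unset Printing Implicit Defensive.
Import GRing.Theory Num.Theory.
Local Open Scope ring_scope.

Definition cell (n : nat) := {ffun 'I_n -> int}.

Definition origin (n : nat) : cell n := [ffun _ => 0].

(* A direction (sign, dimension): sign true = +1, false = -1;
   dimension d : 'I_n.+1, where d = 0 means "stay" and d = i.+1 means
   coordinate i (0-based), i.e. dimension i+1 in 1-based numbering. *)
Definition direction (n : nat) := (bool * 'I_n.+1)%type.

Definition move (n : nat) (c : cell n) (dir : direction n) : cell n :=
  [ffun k : 'I_n =>
     c k + (if nat_of_ord dir.2 == k.+1 then (if dir.1 then 1 else -1) else 0)].

Record protocol (n m : nat) := Protocol {
  pstate : finType;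
  pdelta : pstate -> {set pstate} -> pstate * direction n;
  pinit : 'I_m -> pstate
}.

Definition config (n m : nat) (P : protocol n m) :=
  'I_m -> (cell n * pstate P)%type.

Definition init_config (n m : nat) (P : protocol n m) : config P :=
  fun i => (origin n, pinit P i).

Definition observed (n m : nat) (P : protocol n m) (C : config P) (c : cell n)
  : {set pstate P} :=
  [set (C j).2 | j in [pred j : 'I_m | (C j).1 == c]].

Definition step (n m : nat) (P : protocol n m) (A : {set 'I_m}) (C : config P)
  : config P :=
  fun i =>
    if i \in A then
      let r := pdelta (C i).2 (observed C (C i).1) in
      (move (C i).1 r.2, r.1)
    else C i.

Fixpoint run (n m : nat) (P : protocol n m) (s : nat -> {set 'I_m}) (t : nat)
  : config P :=
  match t with
  | 0 => init_config P
  | t'.+1 => step (s t') (run P s t')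
  end.

Definition explores (n m : nat) (P : protocol n m) (s : nat -> {set 'I_m}) : Prop :=
  forall c : cell n, exists (t : nat) (i : 'I_m), ((run P s t) i).1 = c.

Definition sync_schedule (m : nat) : nat -> {set 'I_m} := fun _ => setT.

(* Semi-synchronous model: arbitrary schedule in which each agent is active
   infinitely often (the agents are deterministic, so an omniscient adaptive
   adversary is equivalent to an arbitrary fixed schedule). *)
Definition fair (m : nat) (s : nat -> {set 'I_m}) : Prop :=
  forall (i : 'I_m) (t : nat), exists t', (t <= t')%N /\ i \in s t'.

Definition sync_explores (n m : nat) (P : protocol n m) : Prop :=
  explores P (sync_schedule m).

Definition ssync_explores (n m : nat) (P : protocol n m) : Prop :=
  forall s : nat -> {set 'I_m}, fair s -> explores P s.

(* Main.v *)
From HB Require Import structures.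
Require Import Defs.
From mathcomp Require Import all_boot all_order all_algebra.
From mathcomp Require Import zify.
Set Implicit Arguments. Unset Strict Implicit. Unset Printing Implicit Defensive.
Import Order.TTheory GRing.Theory Num.Theory.

(* Both teams simulate one and the same machine, which has a finite mode, one
   natural number d and a cell x. In each step it reads its mode and d modulo a
   constant, and either increments d, or multiplies d by a rational constant
   num/den (with den dividing d) while moving x to a neighbouring cell.

   Such a machine can visit every cell. Give each of the 2n directions j two
   distinct primes, main j and aux j. The machine runs through N = 1, 2, 3, ...;
   if N is prime to all aux j, it starts from d = N and the origin, trades
   factors main j for factors aux j moving in direction j each time, until it
   stands at the sum of v_(main j)(N) times direction j, and then trades them
   back, which restores d = N and the origin. Every cell is reached from a
   suitable product of powers of the main j.

   The number d is a distance between two agents on a line parallel to the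
   first axis. Synchronously, the third agent bounces between them while the
   far agent drifts at speed (num - den) / (num + den), so that it is caught
   exactly at distance d * num / den. Semi-synchronously, d is moved from a
   marker on one side of a base marker to a marker on the other side, in
   portions of den against num. The markers carry no memory: the fourth agent
   displays an order, and waits until the marker has left its cell. Hence at
   each time exactly one agent can change the configuration, and the adversary
   can only delay the run. *)

(** * Geometry and configurations *)

Section Geometry.
Local Open Scope ring_scope.
Variable n : nat.
Implicit Types (x : cell n.+1) (d : direction n.+1) (u v : int) (f : bool).

Definition stay : direction n.+1 := (true, ord0).
Definition axis f : direction n.+1 := (f, lift ord0 ord0).
Definition slide x u : cell n.+1 :=
  [ffun k : 'I_n.+1 => x k + (if k == ord0 then u else 0)].

Lemma move_stay x : move x stay = x.
Proof. by apply/ffunP=> k; rewrite ffunE /= addr0. Qed.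

Lemma slide0 x : slide x 0 = x.
Proof. by apply/ffunP=> k; rewrite ffunE if_same addr0. Qed.

Lemma move_axis x u f :
  move (slide x u) (axis f) = slide x (u + (if f then 1 else -1)).
Proof.
apply/ffunP=> k; rewrite !ffunE /= /bump /= -val_eqE /= eqSS eq_sym.
by case: eqP => _; rewrite ?addr0 ?addrA.
Qed.

Lemma move_slide x u d : move (slide x u) d = slide (move x d) u.
Proof. by apply/ffunP=> k; rewrite !ffunE addrAC. Qed.

Lemma eq_slide x u v : (slide x u == slide x v) = (u == v).
Proof.
apply/eqP/eqP=> [/ffunP/(_ ord0)|->//].
by rewrite !ffunE eqxx => /addrI.
Qed.

Lemma eq_slide0 x u : (slide x u == x) = (u == 0).
Proof. by rewrite -{2}(slide0 x) eq_slide. Qed.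

Lemma move_neq x d : d.2 != ord0 -> (move x d == x) = false.
Proof.
case: d => s d /=; case: (unliftP ord0 d) => [i ->|->]; last by rewrite eqxx.
move=> _; apply/eqP=> /ffunP/(_ i); rewrite !ffunE /= /bump /= add1n eqxx.
by rewrite -{2}(addr0 (x i)) => /addrI; case: s.
Qed.

End Geometry.

(** * Teams whose agents carry distinct names *)

Section Tagged.
Variables (n m : nat) (T X : finType) (e : 'I_m -> T) (e' : T -> 'I_m).
Hypotheses (eK : cancel e e') (e'K : cancel e' e).
Variables (trans : T -> X -> {ffun T -> option X} -> X * direction n).
Variable (x0 : T -> X).

Definition tconfig := {ffun T -> (cell n * X)%type}.

Definition peek (O : {set (T * X)%type}) : {ffun T -> option X} :=
  [ffun t => [pick x | (t, x) \in O]].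

(** Keeping the name in the state lets agents of one automaton run different programs, and lets an
    observed set show who is present. *)
Definition tagged_protocol : protocol n m :=
  @Protocol n m (T * X)%type
    (fun q O => let r := trans q.1 q.2 (peek O) in ((q.1, r.1), r.2))
    (fun i => (e i, x0 (e i))).

Definition view (C : tconfig) (c : cell n) : {ffun T -> option X} :=
  [ffun t => if (C t).1 == c then Some (C t).2 else None].

Definition tstep (A : {set T}) (C : tconfig) : tconfig :=
  [ffun t => if t \in A then
     let r := trans t (C t).2 (view C (C t).1) in (move (C t).1 r.2, r.1)
   else C t].

Definition tinit : tconfig := [ffun t => (origin n, x0 t)].

Fixpoint trun (s : nat -> {set 'I_m}) (t : nat) : tconfig :=
  if t is t'.+1 then tstep (e' @^-1: s t') (trun s t') else tinit.

(** Names are distinct and never change, so an observed set holds at most one pair with a given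
    name; hence the [pick] in [peek] recovers exactly the [view]. *)
Lemma run_tagged_protocol s t i :
  run tagged_protocol s t i =
  ((trun s t (e i)).1, (e i, (trun s t (e i)).2)).
Proof.
elim: t i => [|t IH] i /=; first by rewrite ffunE.
rewrite /step ffunE inE eK; case: ifP => iA; last exact: IH.
rewrite !IH /=; set O := peek _.
suff -> : O = view (trun s t) (trun s t (e i)).1 by [].
apply/ffunP=> a; rewrite !ffunE.
have obsE y : ((a, y) \in observed (run tagged_protocol s t) (trun s t (e i)).1) =
    ((trun s t a).1 == (trun s t (e i)).1) && ((trun s t a).2 == y).
  apply/imsetP/andP=> [[j]|[/eqP ha /eqP hy]].
    by rewrite inE !IH /= => ja [-> ->].
  by exists (e' a); rewrite ?inE !IH e'K /= ?ha ?hy.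
case: pickP => [y|h]; first by rewrite obsE; case: ifP => //= _ /eqP ->.
by move: (h (trun s t a).2); rewrite obsE eqxx andbT => ->.
Qed.

End Tagged.

(** * Reachability under a deterministic step *)

Section Reach.
Variables (C : Type) (nxt : C -> C).
Definition reach c c' := exists k, iter k nxt c = c'.

Lemma reach_refl c : reach c c.
Proof. by exists 0. Qed.

Lemma reach_trans c2 c1 c3 : reach c1 c2 -> reach c2 c3 -> reach c1 c3.
Proof. by case=> k <- [l <-]; exists (l + k); rewrite iterD. Qed.

Lemma reach_step c c' : reach (nxt c) c' -> reach c c'.
Proof. by apply: reach_trans; exists 1. Qed.

End Reach.

(** * The simulated machine *)

(** Divisions are exact by [rule_dvd], which is asked only for positive [d]; [mode0_inc] handles the
    start at 0, after which [d] stays positive. *)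
Record machine (n : nat) := Machine {
  mode : finType;
  op : finType;
  modulus : nat;
  modulus_gt0 : 0 < modulus;
  den : op -> nat;
  num : op -> nat;
  den_gt0 : forall o, 0 < den o;
  num_gt0 : forall o, 0 < num o;
  heading : op -> direction n;
  heading_neq0 : forall o, (heading o).2 != ord0;
  rule : mode -> nat -> mode * option op;
  rule_dvd : forall s d s' o,
    0 < d -> rule s (d %% modulus) = (s', Some o) -> den o %| d;
  mode0 : mode;
  mode0_inc : (rule mode0 0).2 = None
}.

Definition mstate n (M : machine n) := (mode M * nat * cell n)%type.

Definition mstep n (M : machine n) (c : mstate M) : mstate M :=
  let: (s, d, x) := c in
  let r := rule s (d %% modulus M) in
  if r.2 is Some o then (r.1, d %/ den o * num o, move x (heading o))
  else (r.1, d.+1, x).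

Definition minit n (M : machine n) : mstate M := (mode0 M, 0, origin n).

Lemma mstep_gt0 n (M : machine n) (c : mstate M) :
  0 < (mstep c).1.2 \/ c.1.2 = 0.
Proof.
case: c => [[s [|d]] x] /=; [by right | left].
case E: (rule _ _) => [s' [o|]] //=.
have := rule_dvd (ltn0Sn d) E; case/dvdnP=> q dE.
rewrite dE mulnK ?den_gt0 // muln_gt0 num_gt0 andbT.
by case: q dE.
Qed.

Lemma iter_mstep_gt0 n (M : machine n) k : 0 < (iter k.+1 (@mstep n M) (minit M)).1.2.
Proof.
elim: k => [|k IH]; first by rewrite /= mod0n mode0_inc.
by rewrite iterS; case: (mstep_gt0 (iter k.+1 (@mstep n M) (minit M))) IH => // ->.
Qed.

(** * Three synchronous agents *)

Section Sync.
Local Open Scope ring_scope.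
Variables (n : nat) (M : machine n.+1).
Local Notation K := (modulus M).

Definition period (o : option (op M)) :=
  if o is Some o then (den o + num o)%N else 1%N.
Definition bound := (K + \sum_(o : op M) (den o + num o))%N.

(** The boolean tells whether the bouncing agent is on its way to the far end. The counter is its
    distance modulo [K]; in the far end it is the phase of the drift. *)
Definition state3 := (bool * mode M * option (op M) * 'I_bound.+1)%type.

Definition heading_of (o : option (op M)) : direction n.+1 :=
  if o is Some o then heading o else stay n.

(* A mean speed of (num - den) / (num + den), with the moves first: resting last
   keeps the far end out of reach until a period is complete. *)
Definition drift (o : option (op M)) (i : nat) : direction n.+1 :=
  if o is Some o then
    if (num o <= den o)%N then (if (i < den o - num o)%N then axis n false else stay n)
    else (if (i < num o - den o)%N then axis n true else stay n)
  else stay n.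

Definition transA (x : state3) (e : option state3) : state3 * direction n.+1 :=
  (x, if e is Some (false, _, o, _) then heading_of o else stay n).

(** At a meeting with the rightward bouncing agent, the far end evaluates the same rule on the same
    data as [transE], so both learn the new operation in the same step. *)
Definition transB (x : state3) (e : option state3) : state3 * direction n.+1 :=
  let: (_, _, o, i) := x in
  if e is Some (true, s', _, k) then
    let o' := (rule s' k).2 in
    ((false, mode0 M, o', ord0), if o' is Some o'' then heading o'' else axis n true)
  else ((false, mode0 M, o, inord (i.+1 %% period o)), drift o i).

Definition transE (x : state3) (atA atB : bool) : state3 * direction n.+1 :=
  let: (rightward, s, o, k) := x in
  if rightward then
    if atB then
      let r := rule s k in
      if atA then ((true, r.1, r.2, ord0), stay n)
      else ((false, r.1, r.2, ord0), axis n false)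
    else ((true, s, o, inord (k.+1 %% K)), axis n true)
  else if atA then ((true, s, o, ord0), heading_of o)
  else (x, axis n false).

(* None is the bouncing agent, Some false the near and Some true the far end. *)
Definition trans3 (t : option bool) (x : state3) (v : {ffun option bool -> option state3}) :
  state3 * direction n.+1 :=
  match t with
  | Some false => transA x (v None)
  | Some true => transB x (v None)
  | None => transE x (v (Some false)) (v (Some true))
  end.

Definition start3 (t : option bool) : state3 :=
  (t == None, mode0 M, None, ord0).

Definition mk3 xA xB (y : state3) xE (z : state3) : tconfig n.+1 (option bool) state3 :=
  [ffun t => match t with
   | Some false => (xA, start3 (Some false))
   | Some true => (xB, y)
   | None => (xE, z)
   end].

Definition see (xE x : cell n.+1) (z : state3) := if xE == x then Some z else None.

Lemma step3E xA xB y xE z :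
  tstep trans3 setT (mk3 xA xB y xE z) =
  mk3 (move xA (transA (start3 (Some false)) (see xE xA z)).2)
      (move xB (transB y (see xE xB z)).2) (transB y (see xE xB z)).1
      (move xE (transE z (xA == xE) (xB == xE)).2)
      (transE z (xA == xE) (xB == xE)).1.
Proof.
by apply/ffunP=> -[[]|]; rewrite !ffunE inE /= !ffunE //=; do 2?case: ifP.
Qed.


Definition drift_sign (o : option (op M)) (i : nat) : int :=
  if o is Some o then
    if (num o <= den o)%N then (if (i < den o - num o)%N then -1 else 0)
    else (if (i < num o - den o)%N then 1 else 0)
  else 0.

Fixpoint disp (o : option (op M)) (t : nat) : int :=
  if t is t'.+1 then disp o t' + drift_sign o (t' %% period o) else 0.

Lemma move_drift x u o i :
  move (slide x u) (drift o i) = slide x (u + drift_sign o i).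
Proof.
by case: o => [o|] /=; do 2?[case: ifP => _];
   rewrite ?move_stay ?addr0 // move_axis.
Qed.

Lemma period_gt0 o : (0 < period o)%N.
Proof. by case: o => //= o; rewrite ltn_addr ?den_gt0. Qed.

Lemma leq_bound o : (period o <= bound.+1)%N.
Proof.
case: o => //= o; rewrite /bound (bigD1 o) //=; lia.
Qed.

Lemma modulus_bound d : (d %% K < bound.+1)%N.
Proof.
by have := ltn_pmod d (modulus_gt0 M); rewrite /bound; lia.
Qed.

Definition phase (o : option (op M)) t : state3 := (false, mode0 M, o, inord (t %% period o)).

Lemma phase0 o : phase o 0 = (false, mode0 M, o, ord0).
Proof. by congr (_, _); apply/val_inj; rewrite /= mod0n inordK. Qed.

Lemma disp_None t : disp None t = 0.
Proof. by elim: t => //= t ->. Qed.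

Lemma transB_phase o t z : 
  (if z is Some (true, _, _, _) then false else true) ->
  transB (phase o t) z = (phase o t.+1, drift o (t %% period o)).
Proof.
move=> hz; rewrite /transB /= /phase inordK; last first.
  exact: leq_trans (ltn_pmod _ (period_gt0 o)) (leq_bound o).
by rewrite -[(t %% _).+1]addn1 modnDml addn1; case: z hz => [[[[[]]]]|].
Qed.

Local Arguments transB : simpl never.
Local Arguments phase : simpl never.
Local Notation nxt := (tstep trans3 setT).

(** The far end may share a cell with the bouncing agent here: on its way left, that agent ignores
    it and does not disturb its drift. *)
Lemma left_walk x y (v : int) s' o k t (u : nat) :
  reach nxt
    (mk3 x (slide y (v + disp o t)) (phase o t) (slide x u%:Z) (false, s', o, k))
    (mk3 x (slide y (v + disp o (t + u))) (phase o (t + u)) x (false, s', o, k)).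
Proof.
elim: u t => [|u IH] t; first by rewrite addn0 slide0; apply: reach_refl.
apply: reach_step; rewrite step3E /= transB_phase; last by rewrite /see; case: ifP.
rewrite /see [x == _]eq_sym !eq_slide0 /= move_stay move_drift -addrA move_axis.
have -> : (u.+1%:Z + -1 = u%:Z)%R by lia.
by rewrite addnS -addSn; exact: (IH t.+1).
Qed.

Lemma right_walk y (v : int) s' o t (u : nat) :
  (forall i, (i < u)%N -> v + disp o (t + i) != i%:Z) ->
  reach nxt
    (mk3 y (slide y (v + disp o t)) (phase o t) y (true, s', o, ord0))
    (mk3 y (slide y (v + disp o (t + u))) (phase o (t + u)) (slide y u%:Z)
       (true, s', o, inord (u %% K))).
Proof.
elim: u => [|u IH] h.
  rewrite addn0 slide0 mod0n; have -> : inord 0 = ord0 :> 'I_bound.+1.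
    by apply/val_inj; rewrite /= inordK.
  exact: reach_refl.
apply: reach_trans (IH _) _ => [i iu|]; first by apply: h; apply: leqW.
have hB : (slide y (v + disp o (t + u)) == slide y u%:Z) = false.
  by rewrite eq_slide; apply/negbTE/h.
apply: reach_step; rewrite step3E /= hB /see [slide y u == slide _ _]eq_sym hB.
rewrite transB_phase // move_drift -addrA /= inordK ?modulus_bound //.
rewrite -[(u %% K).+1]addn1 modnDml addn1 move_axis addnS /=.
have -> : (u%:Z + 1 = u.+1%:Z)%R by lia.
by case: ifP => _ /=; rewrite move_stay; apply: reach_refl.
Qed.

(* The bouncing agent loses one step when it shifts the near end to the new line;
   the far end loses the same step at the start. *)
Lemma bounce x D (y : state3) s s' o o0 v u :
  (0 < D)%N -> rule s (D %% K) = (s', o) ->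
  move (slide x D) (if o is Some o' then heading o' else axis n true) =
    slide (move x (heading_of o)) v ->
  (forall i, (i < u)%N -> v + disp o (D + i) != i%:Z) ->
  v + disp o (D + u) = u%:Z ->
  reach nxt
    (mk3 x (slide x D) y (slide x D) (true, s, o0, inord (D %% K)))
    (let x' := move x (heading_of o) in
     mk3 x' (slide x' u) (phase o (D + u)) (slide x' u)
       (true, s', o, inord (u %% K))).
Proof.
case: D => // D _ hr hv hne hu /=.
set x' := move x _ in hv *.
apply: reach_step; rewrite step3E /= /transB.
case: y => [[[tag sB] oB] iB]; rewrite /see eqxx inordK ?modulus_bound // hr /=.
rewrite [x == _]eq_sym !eq_slide0 /= move_stay hv move_axis.
have -> : (D.+1%:Z - 1 = D%:Z)%R by lia.
rewrite -phase0; have hl0 := left_walk x x' v s' o ord0 0 D.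
move: hl0; rewrite add0n /= addr0 => hl; apply: reach_trans hl _.
(* The meeting was followed by [D] steps to the near end. This step carries the near end and the
   bouncing agent to the new line, so the way out begins at phase [D.+1], the old distance. *)
apply: reach_step; rewrite step3E /= /see !eqxx /= transB_phase; last by case: ifP.
rewrite move_drift -/x'; have := @right_walk x' v s' o D.+1 u hne.
by rewrite /= addrA hu addSn.
Qed.
(** A full period shifts the far end by [num - den]; the minimum counts the moves already made in
    the current period, where they come first. The bound on [j] admits a whole period, from which
    the induction on [q] restarts. *)
Lemma disp_Some o q j : (j <= period (Some o))%N ->
  disp (Some o) (q * period (Some o) + j) =
  (num o)%:Z * q%:Z - (den o)%:Z * q%:Z +
  (if (num o <= den o)%N then - (minn j (den o - num o))%:Z
   else (minn j (num o - den o))%:Z).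
Proof.
set c := period _; have cE : c = (den o + num o)%N by [].
have c0 : (0 < c)%N by rewrite cE addn_gt0 den_gt0.
have dS t : disp (Some o) t.+1 = disp (Some o) t + drift_sign (Some o) (t %% c) by [].
elim: q j => [|q IHq] j.
  rewrite add0n; elim: j => [|j IHj] jc.
    by rewrite /= !mulr0 !min0n oppr0 if_same.
  rewrite [disp _ _]/= IHj ?modn_small //; last by apply: ltnW.
  by do 2?case: ifP => ?; lia.
elim: j => [|j IHj] jc.
  rewrite mulSnr addn0 IHq // cE; case: ifP => ?; nia.
rewrite addnS dS (IHj (ltnW jc)) modnMDl modn_small //=.
by do 2?case: ifP => ?; lia.
Qed.

(** [D + u] is exactly [q] periods, in which the far end drifts by [q * (num - den)]. *)
Lemma disp_meet o q : 
  let D := (q * den o)%N in let u := (q * num o)%N in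
  D%:Z + disp (Some o) (D + u) = u%:Z.
Proof.
move=> D u; have -> : (D + u = q * period (Some o) + 0)%N by rewrite addn0 -mulnDr.
by rewrite disp_Some // !min0n; case: ifP => _; rewrite /D /u; lia.
Qed.

(** After [e < q] periods and [j] further steps, the gap is [2 * den * (q - e) - j] plus the drift
    within the current period. It is positive because [j < den + num] and the moves precede the
    rests. *)
Lemma disp_before o q i :
  let D := (q * den o)%N in
  (i < q * num o)%N -> D%:Z + disp (Some o) (D + i) != i%:Z.
Proof.
move=> D iq; set c := period (Some o).
have cE : c = (den o + num o)%N by [].
have c0 : (0 < c)%N by rewrite cE addn_gt0 den_gt0.
have tq : (D + i < q * c)%N by rewrite cE mulnDr ltn_add2l.
rewrite (divn_eq (D + i) c) disp_Some; last exact/ltnW/ltn_pmod.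
have := divn_eq (D + i) c; have := ltn_pmod (D + i) c0.
have : ((D + i) %/ c < q)%N by rewrite ltn_divLR.
move: (_ %/ _)%N (_ %% _)%N => e j; rewrite cE => eq jc tE.
apply/eqP; rewrite /D in tE *; have := den_gt0 o; have := num_gt0 o.
by case: ifP => ?; nia.
Qed.

(** The machine state is read off when the bouncing agent has just reached the far end. The state
    [y] and the operation [o] are free because the next step overwrites both. *)
Definition represents3 (c : mstate M) (C : tconfig n.+1 (option bool) state3) :=
  let: (s, d, x) := c in
  exists y o, C = mk3 x (slide x d) y (slide x d) (true, s, o, inord (d %% K)).

Lemma sync_step c C : (0 < c.1.2)%N -> represents3 c C ->
  exists2 C', reach nxt C C' & represents3 (mstep c) C'.
Proof.
case: c => [[s d] x] /= d0 [y [o0 ->]].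
case E: (rule s (d %% K)) => [s' [o|]] /=.
- case/dvdnP: (rule_dvd d0 E) => q dE; rewrite dE mulnK ?den_gt0 //.
  eexists; last by eexists; eexists.
  rewrite -dE; apply: (@bounce x d y s s' (Some o) _ d (q * num o)) => //.
  + by rewrite move_slide.
  + by move=> i iq; rewrite dE; apply: disp_before.
  + by rewrite dE; apply: disp_meet.
- exists (mk3 x (slide x d.+1) (phase None (d + d.+1)) (slide x d.+1)
       (true, s', None, inord (d.+1 %% K))); last by eexists; eexists.
  have := @bounce x d y s s' None o0 d.+1 d.+1 d0 E.
  rewrite /= move_stay; apply.
  + by rewrite move_axis; congr slide; lia.
  + by move=> i id; rewrite disp_None; apply/eqP; lia.
  + by rewrite disp_None addr0.
Qed.

Lemma sync_reach k : exists2 C,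
  reach nxt (tinit n.+1 start3) C & represents3 (iter k (@mstep _ M) (minit M)) C.
Proof.
case: k => [|k].
  exists (tinit n.+1 start3); first exact: reach_refl.
  exists (start3 (Some true)), None; apply/ffunP=> t; rewrite !ffunE.
  rewrite mod0n !slide0; case: t => [[]|] //; congr (_, (_, _)).
  by apply/val_inj; rewrite /= inordK.
elim: k => [|k [C hC rC]].
  (* At [d = 0] all three agents share a cell. By [mode0_inc] the first rule is an increment: the
     far end steps to 1 and the bouncing agent follows. *)
  case E: (rule (mode0 M) 0) => [s' o].
  have {o E} E : rule (mode0 M) 0 = (s', None).
    by rewrite E; have := mode0_inc M; rewrite E /= => ->.
  have -> : tinit n.+1 start3 =
      mk3 (origin _) (origin _) (start3 (Some true)) (origin _) (start3 None).
    by apply/ffunP=> -[[]|]; rewrite !ffunE.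
  have := @right_walk (origin _) 1 s' None 0 1; rewrite !disp_None addr0 => h.
  eexists; last first.
    rewrite /= mod0n E /=.
    by exists (phase None 1), None; eexists.
  apply: reach_step; rewrite step3E /= /see eqxx /= /transB E /= !move_stay.
  rewrite -{2}(slide0 (origin _)) move_axis add0r -phase0.
  by apply: h => -[|//] _; rewrite disp_None.
have [C' CC' rC'] := sync_step (iter_mstep_gt0 M k) rC.
by exists C' => //; apply: reach_trans CC'.
Qed.

Lemma sync_machine : exists P : protocol n.+1 3, forall k, exists t i,
  (run P (sync_schedule 3) t i).1 = (iter k (@mstep _ M) (minit M)).2.
Proof.
have cardT : #|{: option bool}| = 3 by rewrite card_option card_bool.
pose e (i : 'I_3) : option bool := enum_val (cast_ord (esym cardT) i).
pose e' (t : option bool) : 'I_3 := cast_ord cardT (enum_rank t).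
have eK : cancel e e' by move=> i; rewrite /e /e' enum_valK cast_ordKV.
have e'K : cancel e' e by move=> t; rewrite /e /e' cast_ordK enum_rankK.
exists (tagged_protocol e trans3 start3) => k.
have [C [t tC]] := sync_reach k.
(* The near end stands in the cell of the machine. *)
case: (iter _ _ _) => [[s d] x] [y [o CE]]; exists t, (e' (Some false)).
rewrite (run_tagged_protocol eK e'K) e'K /=.
have -> : trun e' trans3 start3 (sync_schedule 3) t = C.
  rewrite -tC; elim: t {tC} => //= t ->; congr tstep.
  by apply/setP=> a; rewrite !inE.
by rewrite CE ffunE.
Qed.

End Sync.

(** * Four semi-synchronous agents *)

(** Each machine step starts with [Read]. An increment goes on with [GoInc] and [DoInc]. An
    operation runs through rounds of [Out], [GoIn], [In], [Test], [GoOut]; its last [Test] leads to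
    the four turning tasks, which shift the markers to the new line and swap sides. *)
Inductive task :=
  Read | GoInc | DoInc | Out | GoIn | In | Test | GoOut
| TurnMain | TurnBase | GoTurn | TurnOther.

Definition task_code (t : task) : 'I_12 :=
  inord match t with
  | Read => 0 | GoInc => 1 | DoInc => 2 | Out => 3 | GoIn => 4 | In => 5
  | Test => 6 | GoOut => 7 | TurnMain => 8 | TurnBase => 9 | GoTurn => 10
  | TurnOther => 11
  end.

Definition task_decode (i : 'I_12) : option task :=
  nth None (map Some [:: Read; GoInc; DoInc; Out; GoIn; In; Test; GoOut;
    TurnMain; TurnBase; GoTurn; TurnOther]) i.

Lemma task_codeK : pcancel task_code task_decode.
Proof. by case; rewrite /task_decode /task_code inordK. Qed.

HB.instance Definition _ := Finite.copy task (pcan_type task_codeK).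

Section SemiSync.
Local Open Scope ring_scope.
Variables (n : nat) (M : machine n.+1).
Local Notation K := (modulus M).
Local Notation bound := (bound M).

Definition state4 := (task * bool * mode M * option (op M) * 'I_bound.+1)%type.

Definition den_of (o : option (op M)) := if o is Some o then den o else 1%N.
Definition num_of (o : option (op M)) := if o is Some o then num o else 1%N.

(* None is the base marker, Some true and Some false the markers on its positive
   and negative side; f is the side of the marker whose distance from the base is
   d, and the other marker waits at the base. *)
Definition look (y : state4) : option bool :=
  let: (t, f, _, _, _) := y in
  match t with
  | Read | Test | TurnBase => None
  | GoInc | DoInc | GoIn | In | TurnMain => Some f
  | Out | GoOut | GoTurn | TurnOther => Some (~~ f)
  end.

Definition order (y : state4) : option (direction n.+1) :=
  let: (t, f, _, o, _) := y in
  match t with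
  | DoInc => Some (axis n f)
  | Out | In => Some (axis n (~~ f))
  | TurnMain | TurnBase | TurnOther => Some (heading_of o)
  | _ => None
  end.

(** For a task with an order, this applies only once the watched marker has left the cell; those
    branches follow the marker or pass to the next task. *)
Definition act (y : state4) (seen : bool) : state4 * direction n.+1 :=
  let: (t, f, s, o, i) := y in
  let goto t := ((t, f, s, o, ord0), stay n) in
  match t with
  | Read =>
    if seen then
      let r := rule s i in
      ((if r.2 then Out else GoInc, f, r.1, r.2, ord0), stay n)
    else ((Read, f, s, o, inord (i.+1 %% K)), axis n (~~ f))
  | GoInc => if seen then goto DoInc else (y, axis n f)
  | DoInc => ((Read, f, s, o, ord0), axis n f)
  | Out =>
    (if (i.+1 < num_of o)%N then (Out, f, s, o, inord i.+1)
     else (GoIn, f, s, o, ord0), axis n (~~ f))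
  | GoIn => if seen then goto In else (y, axis n f)
  | In =>
    (if (i.+1 < den_of o)%N then (In, f, s, o, inord i.+1)
     else (Test, f, s, o, ord0), axis n (~~ f))
  | Test => goto (if seen then TurnMain else GoOut)
  | GoOut => if seen then goto Out else (y, axis n (~~ f))
  | TurnMain => goto TurnBase
  | TurnBase => goto GoTurn
  | GoTurn => if seen then goto TurnOther else (y, axis n (~~ f))
  | TurnOther => ((Read, ~~ f, s, o, ord0), heading_of o)
  end.

Definition trans4 (a : option (option bool)) (y : state4)
    (v : {ffun option (option bool) -> option state4}) : state4 * direction n.+1 :=
  match a with
  | None =>
    let seen : bool := v (Some (look y)) in
    if order y && seen then (y, stay n) else act y seen
  | Some j =>
    (y, match v None with
        | Some z =>
          if look z == j then (if order z is Some d then d else stay n) else stay n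
        | None => stay n
        end)
  end.

Definition start4 (a : option (option bool)) : state4 :=
  (Read, true, mode0 M, None, ord0).

Definition conf := ({ffun option bool -> cell n.+1} * cell n.+1 * state4)%type.

Definition embed (c : conf) : tconfig n.+1 (option (option bool)) state4 :=
  let: (p, x, y) := c in
  [ffun a => if a is Some j then (p j, start4 a) else (x, y)].

Definition nxt4 (c : conf) : conf :=
  let: (p, x, y) := c in
  let seen := p (look y) == x in
  match order y, seen with
  | Some d, true => ([ffun j => if look y == j then move (p j) d else p j], x, y)
  | _, _ => (p, move x (act y seen).2, (act y seen).1)
  end.

Definition enabled (c : conf) : option (option bool) :=
  let: (p, x, y) := c in
  if order y && (p (look y) == x) then Some (look y) else None.

Lemma embedE c a :
  embed c a = if a is Some j then (c.1.1 j, start4 a) else (c.1.2, c.2).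
Proof. by case: c => [[p x] y]; rewrite ffunE. Qed.

(** Activating an agent that is not enabled changes nothing: the fourth agent waits while its order
    can be obeyed, and a marker moves only on an order addressed to it from its own cell. *)
Lemma step4 A c :
  tstep trans4 A (embed c) = if enabled c \in A then embed (nxt4 c) else embed c.
Proof.
apply/ffunP=> a; rewrite ffunE [RHS](fun_if (fun C : tconfig n.+1 _ state4 => C a)).
rewrite !embedE /=; case: c => [[p x] y]; rewrite /nxt4 /enabled ?ffunE ?embedE /=.
case: a => [j|] /=; rewrite ?ffunE ?embedE /=.
  rewrite [x == _]eq_sym; have [<-|neq] := eqVneq (look y) j.
    by case: (p _ == x) => /=; case: (order y) => [d|] /=;
       rewrite ?ffunE ?eqxx ?move_stay ?if_same.
  by case: (p j == x) => /=; rewrite ?(negPf neq) ?move_stay;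
     case: (order y) => [d|] /=; case: (p (look y) == x) => /=;
     rewrite ?ffunE ?(negPf neq) ?if_same.
case: (order y) => [d|] /=; last by case: (p (look y) == x).
by case: (p (look y) == x) => /=; rewrite ?move_stay; do ?case: ifP.
Qed.

Lemma fair_iter (e : 'I_4 -> option (option bool)) e' (s : nat -> {set 'I_4}) k :
  cancel e' e -> cancel e e' -> fair s ->
  exists t, trun e' trans4 start4 s t =
    embed (iter k nxt4 ([ffun=> origin _], origin _, start4 None)).
Proof.
move=> e'K eK fs; elim: k => [|k [t IH]].
  by exists 0%N; apply/ffunP=> -[j|]; rewrite !ffunE.
set c := iter k _ _ in IH.
(* The first activation of the enabled agent, provided by fairness; until then the configuration is
   frozen. *)
have /ex_minnP[t' /andP[tt' act'] tmin] :
    exists t', (t <= t')%N && (e' (enabled c) \in s t').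
  by have [t' [tt' h]] := fs (e' (enabled c)) t; exists t'; rewrite tt'.
exists t'.+1.
have wait r : (t + r <= t')%N -> trun e' trans4 start4 s (t + r) = embed c.
  elim: r => [|r IHr] tr; first by rewrite addn0.
  rewrite addnS /= IHr; last by lia.
  rewrite step4 inE; case: ifP => // h.
  by have := tmin (t + r)%N; rewrite leq_addr h => /(_ isT); lia.
have := wait (t' - t)%N; rewrite subnKC // => /(_ (leqnn _)) tE.
by rewrite /= tE step4 inE act'.
Qed.

(* Coordinates along the first axis, oriented so that marker f is on the positive
   side. *)
Section Frame.
Variable f : bool.

Definition at_coord (x : cell n.+1) (u : int) := slide x (if f then u else - u).
Definition layout (a b c : cell n.+1) : {ffun option bool -> cell n.+1} :=
  [ffun j => if j is Some g then if g == f then b else c else a].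

Lemma layoutE a b c : 
  (layout a b c None = a) * (layout a b c (Some f) = b) *
  (layout a b c (Some (~~ f)) = c).
Proof. by rewrite !ffunE eqxx; case: f. Qed.

Lemma at0 x : at_coord x 0 = x.
Proof. by rewrite /at_coord oppr0 if_same slide0. Qed.

Lemma eq_at x u v : (at_coord x u == at_coord x v) = (u == v).
Proof. by rewrite /at_coord eq_slide; case: f; rewrite ?eqr_opp. Qed.

Lemma eq_at0 x u : (x == at_coord x u) = (u == 0).
Proof. by rewrite eq_sym -{2}(at0 x) eq_at. Qed.

Lemma move_out x u : move (at_coord x u) (axis n f) = at_coord x (u + 1).
Proof. by rewrite /at_coord move_axis; case: f => //; rewrite opprD. Qed.

Lemma move_in x u : move (at_coord x u) (axis n (~~ f)) = at_coord x (u - 1).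
Proof. by rewrite /at_coord move_axis; case: f => //=; rewrite opprB addrC. Qed.

Lemma move_at x u d : move (at_coord x u) d = at_coord (move x d) u.
Proof. exact: move_slide. Qed.

Lemma order_main a c x y d : order y = Some d -> look y = Some f ->
  nxt4 (layout a x c, x, y) = (layout a (move x d) c, x, y).
Proof.
move=> oy ly; rewrite /nxt4 oy ly layoutE eqxx; congr (_, _, _).
by apply/ffunP=> -[g|]; rewrite !ffunE //; case: (f) g => -[].
Qed.

Lemma order_other a b x y d : order y = Some d -> look y = Some (~~ f) ->
  nxt4 (layout a b x, x, y) = (layout a b (move x d), x, y).
Proof.
move=> oy ly; rewrite /nxt4 oy ly layoutE eqxx; congr (_, _, _).
by apply/ffunP=> -[g|]; rewrite !ffunE //; case: (f) g => -[].
Qed.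

Lemma order_base x b c y d : order y = Some d -> look y = None ->
  nxt4 (layout x b c, x, y) = (layout (move x d) b c, x, y).
Proof.
move=> oy ly; rewrite /nxt4 oy ly layoutE eqxx; congr (_, _, _).
by apply/ffunP=> -[g|]; rewrite !ffunE.
Qed.

Lemma free_step (p : {ffun option bool -> cell n.+1}) x y :
  ~~ (order y && (p (look y) == x)) ->
  nxt4 (p, x, y) = (p, move x (act y (p (look y) == x)).2, (act y (p (look y) == x)).1).
Proof. by rewrite /nxt4; case: (order y) => //= d; case: (_ == _). Qed.

Lemma ord0_inord : inord 0 = ord0 :> 'I_bound.+1.
Proof. by apply/val_inj; rewrite /= inordK. Qed.

Local Notation "c ~> c'" := (reach nxt4 c c') (at level 70).

(** The state may vary along the walk because [Read] counts its steps modulo [K]. *)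
Lemma walk_in (p : {ffun option bool -> cell n.+1}) x (v : int) (ys : nat -> state4) u :
  (forall i, (i < u)%N -> [/\ order (ys i) = None,
     act (ys i) false = (ys i.+1, axis n (~~ f)) &
     p (look (ys i)) != at_coord x (v - i%:Z)]) ->
  (p, at_coord x v, ys 0%N) ~> (p, at_coord x (v - u%:Z), ys u).
Proof.
elim: u => [|u IH] h; first by rewrite subr0; apply: reach_refl.
apply: reach_trans (IH _) _ => [i iu|]; first by apply: h; apply: leqW.
have [oy ay py] := h u (leqnn _).
apply: reach_step; rewrite free_step ?oy //= (negPf py) ay /= move_in.
have -> : v - u%:Z - 1 = v - u.+1%:Z by lia.
exact: reach_refl.
Qed.

Lemma walk_out (p : {ffun option bool -> cell n.+1}) x (v : int) y u :
  order y = None -> act y false = (y, axis n f) ->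
  (forall i, (i < u)%N -> p (look y) != at_coord x (v + i%:Z)) ->
  (p, at_coord x v, y) ~> (p, at_coord x (v + u%:Z), y).
Proof.
move=> oy ay; elim: u => [|u IH] h; first by rewrite addr0; apply: reach_refl.
apply: reach_trans (IH _) _ => [i iu|]; first by apply: h; apply: leqW.
apply: reach_step; rewrite free_step ?oy //= (negPf (h u (leqnn _))) ay /= move_out.
have -> : v + u%:Z + 1 = v + u.+1%:Z by lia.
exact: reach_refl.
Qed.

Lemma see_step (p : {ffun option bool -> cell n.+1}) x y y' c' :
  order y = None -> p (look y) = x -> act y true = (y', stay n) ->
  (p, x, y') ~> c' -> (p, x, y) ~> c'.
Proof.
by move=> oy py ay h; apply: reach_step; rewrite free_step ?oy //= py eqxx ay move_stay.
Qed.

Lemma free_reach (p : {ffun option bool -> cell n.+1}) x y c' :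
  p (look y) != x ->
  (p, move x (act y false).2, (act y false).1) ~> c' -> (p, x, y) ~> c'.
Proof.
by move=> py h; apply: reach_step; rewrite free_step (negPf py) ?andbF.
Qed.

Lemma modS_inord d :
  inord ((inord (d %% K) : 'I_bound.+1).+1 %% K) = inord (d.+1 %% K) :> 'I_bound.+1.
Proof.
rewrite inordK ?modulus_bound //; congr inord.
by rewrite -[in LHS]addn1 modnDml addn1.
Qed.

Lemma read_walk x r s o (d : nat) :
  (layout x (at_coord x d) r, at_coord x d, (Read, f, s, o, ord0) : state4) ~>
  (layout x (at_coord x d) r, x, (Read, f, s, o, inord (d %% K)) : state4).
Proof.
have := @walk_in (layout x (at_coord x d) r) x d
  (fun i => (Read, f, s, o, inord (i %% K))) d.
rewrite subrr at0 mod0n ord0_inord; apply=> i id; split=> //=.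
  by rewrite modS_inord.
by rewrite layoutE eq_at0; apply/eqP; lia.
Qed.

(** Each unit takes two steps: the marker obeys and leaves, then the agent finds it gone, follows
    and counts. *)
Lemma push_out a b x w s o i r :
  (i + r.+1 = num o)%N ->
  (layout a b (at_coord x w), at_coord x w, (Out, f, s, Some o, inord i) : state4) ~>
  (layout a b (at_coord x (w - r.+1%:Z)), at_coord x (w - r.+1%:Z),
     (GoIn, f, s, Some o, ord0) : state4).
Proof.
elim: r w i => [|r IH] w i ir; apply: reach_step;
  rewrite (@order_other _ _ _ _ (axis n (~~ f))) // move_in;
  (apply: free_reach; first by rewrite layoutE eq_at; apply/eqP; lia);
  have ib : (i < bound.+1)%N by have := leq_bound (Some o); rewrite /=; lia.
  rewrite /= inordK // ifF; last by lia.
  by rewrite move_in; apply: reach_refl.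
rewrite /= inordK // ifT; last by lia.
rewrite move_in; have := IH (w - 1) i.+1.
have -> : w - 1 - r.+1%:Z = w - r.+2%:Z by lia.
by apply; lia.
Qed.

Lemma push_in a x b w s o i r :
  (i + r.+1 = den o)%N ->
  (layout a (at_coord x w) b, at_coord x w, (In, f, s, Some o, inord i) : state4) ~>
  (layout a (at_coord x (w - r.+1%:Z)) b, at_coord x (w - r.+1%:Z),
     (Test, f, s, Some o, ord0) : state4).
Proof.
elim: r w i => [|r IH] w i ir; apply: reach_step;
  rewrite (@order_main _ _ _ _ (axis n (~~ f))) // move_in;
  (apply: free_reach; first by rewrite layoutE eq_at; apply/eqP; lia);
  have ib : (i < bound.+1)%N by have := leq_bound (Some o); rewrite /=; lia.
  rewrite /= inordK // ifF; last by lia.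
  by rewrite move_in; apply: reach_refl.
rewrite /= inordK // ifT; last by lia.
rewrite move_in; have := IH (w - 1) i.+1.
have -> : w - 1 - r.+1%:Z = w - r.+2%:Z by lia.
by apply; lia.
Qed.

Lemma carry x s o (c q : nat) :
  (layout x (at_coord x (q.+1 * den o)%N%:Z) (at_coord x (- c%:Z)), at_coord x (- c%:Z),
     (Out, f, s, Some o, ord0) : state4) ~>
  (layout x (at_coord x (q * den o)%N%:Z) (at_coord x (- (c + num o)%N%:Z)),
     at_coord x (q * den o)%N%:Z, (Test, f, s, Some o, ord0) : state4).
Proof.
have ngt0 := num_gt0 o; have dgt0 := den_gt0 o.
rewrite -{1}ord0_inord.
apply: reach_trans (@push_out _ _ _ _ _ _ 0 (num o).-1 _) _; first by lia.
rewrite prednK //.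
have -> : - c%:Z - (num o)%:Z = - (c + num o)%N%:Z by lia.
set p := layout _ _ _.
have := @walk_out p x (- (c + num o)%N%:Z) (GoIn, f, s, Some o, ord0)
  (c + num o + q.+1 * den o).
have -> : - (c + num o)%N%:Z + (c + num o + q.+1 * den o)%N%:Z
  = (q.+1 * den o)%N%:Z by lia.
move=> h; apply: reach_trans (h _ _ _) _ => // [i il|].
  by rewrite layoutE eq_at; apply/eqP; lia.
apply: see_step => //; first by rewrite layoutE.
rewrite -{1}ord0_inord.
apply: reach_trans (@push_in _ _ _ _ _ _ 0 (den o).-1 _) _; first by lia.
rewrite prednK //.
have -> : (q.+1 * den o)%N%:Z - (den o)%:Z = (q * den o)%N%:Z by lia.
exact: reach_refl.
Qed.

(** Induction on the portions left, for any distance [c] already gained by the other marker. Exact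
    divisibility brings the emptied marker to the base, where [Test] detects the end. *)
Lemma transfer x s o (c q : nat) :
  (layout x (at_coord x (q.+1 * den o)%N%:Z) (at_coord x (- c%:Z)), at_coord x (- c%:Z),
     (Out, f, s, Some o, ord0) : state4) ~>
  (layout x x (at_coord x (- (c + q.+1 * num o)%N%:Z)), x,
     (TurnMain, f, s, Some o, ord0) : state4).
Proof.
have ngt0 := num_gt0 o; have dgt0 := den_gt0 o.
elim: q c => [|q IH] c; apply: reach_trans (carry _ _ _ _ _) _.
  rewrite mul0n at0 mul1n; apply: reach_step.
  by rewrite free_step //= layoutE eqxx /= move_stay; apply: reach_refl.
apply: free_reach; first by rewrite layoutE eq_at0; apply/eqP; nia.
rewrite /= move_stay; set p := layout _ _ _.
have := @walk_in p x (q.+1 * den o)%N%:Z (fun=> (GoOut, f, s, Some o, ord0))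
  (c + num o + q.+1 * den o).
have -> : (q.+1 * den o)%N%:Z - (c + num o + q.+1 * den o)%N%:Z
  = - (c + num o)%N%:Z by lia.
move=> h; apply: reach_trans (h _) _ => [i il|].
  by split=> //=; rewrite layoutE eq_at; apply/eqP; lia.
apply: see_step => //; first by rewrite layoutE.
by have := IH (c + num o)%N; rewrite -addnA -mulSn.
Qed.

(** The agent sends the two markers at [x] away first, then walks along the old line, which still
    holds the third. *)
Lemma turn x s o (d : nat) (x' := move x (heading o)) :
  (layout x x (at_coord x (- d%:Z)), x, (TurnMain, f, s, Some o, ord0) : state4) ~>
  (layout x' x' (at_coord x' (- d%:Z)), at_coord x' (- d%:Z),
     (Read, ~~ f, s, Some o, ord0) : state4).
Proof.
(* The absence of a marker is the only evidence that it obeyed, so a heading must lead out of the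
   cell. *)
have neq z : move z (heading o) != z by rewrite move_neq ?heading_neq0.
apply: reach_step; rewrite (@order_main _ _ _ _ (heading o)) //.
apply: free_reach; first by rewrite layoutE.
rewrite /= move_stay.
apply: reach_step; rewrite (@order_base _ _ _ _ (heading o)) // -/x'.
apply: free_reach; first by rewrite layoutE neq.
rewrite /= move_stay; set p := layout _ _ _.
have := @walk_in p x 0 (fun=> (GoTurn, f, s, Some o, ord0)) d.
rewrite at0 sub0r => h; apply: reach_trans (h _) _ => [i il|].
  by split=> //=; rewrite layoutE eq_at; apply/eqP; lia.
apply: see_step => //; first by rewrite layoutE.
apply: reach_step; rewrite (@order_other _ _ _ _ (heading o)) //.
apply: free_reach; first by rewrite layoutE neq.
by rewrite /= move_at; apply: reach_refl.
Qed.

Lemma increment x s (d : nat) :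
  (layout x (at_coord x d) x, x, (GoInc, f, s, None, ord0) : state4) ~>
  (layout x (at_coord x d.+1) x, at_coord x d.+1, (Read, f, s, None, ord0) : state4).
Proof.
set p := layout _ (at_coord x d) _.
have := @walk_out p x 0 (GoInc, f, s, None, ord0) d.
rewrite at0 add0r => h; apply: reach_trans (h _ _ _) _ => // [i il|].
  by rewrite layoutE eq_at; apply/eqP; lia.
apply: see_step => //; first by rewrite layoutE.
apply: reach_step; rewrite (@order_main _ _ _ _ (axis n f)) //.
rewrite move_out; have -> : d%:Z + 1 = d.+1%:Z by lia.
apply: free_reach; first by rewrite layoutE eq_at; apply/eqP; lia.
rewrite /= move_out; have -> : d%:Z + 1 = d.+1%:Z by lia.
exact: reach_refl.
Qed.

End Frame.

Lemma at_flip f x u : at_coord (~~ f) x u = at_coord f x (- u).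
Proof. by rewrite /at_coord opprK; case: f. Qed.

Lemma layout_flip f a b c : layout (~~ f) a b c = layout f a c b.
Proof. by apply/ffunP=> -[g|]; rewrite !ffunE //; case: f g => -[]. Qed.

(** The side [f] is existential because every operation carries the distance over to the opposite
    side. *)
Definition represents4 (c : mstate M) (C : conf) :=
  let: (s, d, x) := c in
  exists f o, C = (layout f x (at_coord f x d%:Z) x, at_coord f x d%:Z,
                   (Read, f, s, o, ord0)).

Lemma ssync_step c C : (0 < c.1.2)%N \/ c = minit M -> represents4 c C ->
  exists2 C', reach nxt4 C C' & represents4 (mstep c) C'.
Proof.
case: c => [[s d] x] hc [f [o0 ->]]; rewrite /mstep.
case E: (rule s (d %% K)) => [s' o].
have start c' : reach nxt4 (layout f x (at_coord f x d%:Z) x, x,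
    (if o then Out else GoInc, f, s', o, ord0) : state4) c' ->
  reach nxt4 (layout f x (at_coord f x d%:Z) x, at_coord f x d%:Z,
    (Read, f, s, o0, ord0) : state4) c'.
  move=> h; apply: reach_trans (read_walk _ _ _ _ _ _) _.
  apply: see_step h => //; first by rewrite layoutE.
  by rewrite /= inordK ?modulus_bound // E.
case: o E start => [o|] E start /=; last first.
  eexists; first by apply: start; apply: increment.
  by exists f, None.
(* Here [d = 0] is possible only in the initial state, where [mode0_inc] excludes an operation. *)
have d0 : (0 < d)%N.
  case: hc => // -[sE dE _]; move: E (mode0_inc M).
  by rewrite sE dE mod0n => ->.
have /dvdnP[[|q] dE] := rule_dvd d0 E; first by rewrite dE in d0.
eexists.
  apply: start; have := transfer f x s' o 0 q; rewrite -dE oppr0 at0 => h.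
  by apply: reach_trans h _; apply: turn.
exists (~~ f), (Some o).
by rewrite layout_flip at_flip dE mulnK ?den_gt0.
Qed.

Lemma ssync_machine : exists P : protocol n.+1 4, forall s, fair s ->
  forall k, exists t i, (run P s t i).1 = (iter k (@mstep _ M) (minit M)).2.
Proof.
have cardT : #|{: option (option bool)}| = 4 by rewrite !card_option card_bool.
pose e (i : 'I_4) : option (option bool) := enum_val (cast_ord (esym cardT) i).
pose e' (t : option (option bool)) : 'I_4 := cast_ord cardT (enum_rank t).
have eK : cancel e e' by move=> i; rewrite /e /e' enum_valK cast_ordKV.
have e'K : cancel e' e by move=> t; rewrite /e /e' cast_ordK enum_rankK.
exists (tagged_protocol e trans4 start4) => s fs k.
have [C [j jC] rC] : exists2 C,
    reach nxt4 ([ffun=> origin _], origin _, start4 None) C &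
    represents4 (iter k (@mstep _ M) (minit M)) C.
  elim: k => [|k [C hC rC]].
    eexists; first exact: reach_refl.
    exists true, None; rewrite !at0; congr (_, _, _).
    by apply/ffunP=> -[[]|]; rewrite !ffunE.
  have [|C' CC' rC'] := ssync_step _ rC; last first.
    by exists C' => //; apply: reach_trans CC'.
  by case: k {hC rC} => [|k]; [right | left; apply: iter_mstep_gt0].
have [t tC] := fair_iter j e'K eK fs.
(* The base marker stands in the cell of the machine. *)
case: (iter k _ _) rC => [[m d] x] [f [o CE]]; exists t, (e' (Some None)).
by rewrite (run_tagged_protocol eK e'K) e'K /= tC jC CE !ffunE.
Qed.

End SemiSync.

(** * A machine visiting every cell *)

Fixpoint prime_seq i := if i is i'.+1 then s2val (prime_above (prime_seq i')) else 2.

Lemma prime_seqP i : prime (prime_seq i).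
Proof. by case: i => //= i; case: prime_above. Qed.

Lemma ltn_prime_seq : {mono prime_seq : i j / i < j}.
Proof.
apply: leqW_mono; apply: leq_mono => i j; elim: j => // j IH; rewrite ltnS.
have ltj : prime_seq j < prime_seq j.+1 by rewrite /=; case: prime_above.
by rewrite leq_eqVlt => /predU1P[->|/IH/ltn_trans->].
Qed.

Lemma prime_seq_inj : injective prime_seq.
Proof.
move=> i j eq_ij; apply/eqP; rewrite eqn_leq leqNgt -ltn_prime_seq eq_ij ltnn.
by rewrite leqNgt -ltn_prime_seq eq_ij ltnn.
Qed.

Lemma logn_prod_exp (I : finType) (F y : I -> nat) p :
  prime p -> (forall i, prime (F i)) ->
  logn p (\prod_i F i ^ y i) = \sum_i y i * (p == F i).
Proof.
move=> pp Fp; suff [] : 0 < \prod_i F i ^ y i /\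
  logn p (\prod_i F i ^ y i) = \sum_i y i * (p == F i) by [].
elim/big_ind2: _ => [|m a m' b [m0 <-] [m'0 <-]|i _].
- by rewrite logn1.
- by rewrite muln_gt0 m0 lognM.
- by rewrite expn_gt0 prime_gt0 // lognX logn_prime.
Qed.

Lemma dvdn_prod_exp (I : finType) (F y : I -> nat) p :
  prime p -> (forall i, prime (F i)) ->
  (p %| \prod_i F i ^ y i) = [exists i, (p == F i) && (0 < y i)].
Proof.
move=> pp Fp; rewrite Euclid_dvd_prod // big_orE.
by apply: eq_existsb => i; rewrite Euclid_dvdX // dvdn_prime2.
Qed.

Section Program.
Variable n : nat.
Definition label : finType := (bool * 'I_n)%type.

(** All [aux] primes precede all [main] primes, so a trade of a [main] factor for an [aux] factor
    makes [d] smaller and the forward phase ends. *)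
Definition aux (j : label) := prime_seq (enum_rank j).
Definition main (j : label) := prime_seq (#|label| + enum_rank j).

Lemma aux_prime j : prime (aux j). Proof. exact: prime_seqP. Qed.
Lemma main_prime j : prime (main j). Proof. exact: prime_seqP. Qed.

Lemma aux_inj : injective aux.
Proof. by move=> i j /prime_seq_inj /val_inj /enum_rank_inj. Qed.

Lemma main_inj : injective main.
Proof. by move=> i j /prime_seq_inj /addnI /val_inj /enum_rank_inj. Qed.

Lemma aux_lt_main i j : aux i < main j.
Proof. by rewrite ltn_prime_seq ltn_addr. Qed.

(** A common multiple of all these primes: the remainder of [d] decides which of them divide [d] or
    [d.+1]. *)
Definition prog_modulus := \prod_j (aux j * main j).

Lemma prog_modulus_gt0 : 0 < prog_modulus.
Proof. by apply: prodn_gt0 => j; rewrite muln_gt0 !prime_gt0 ?aux_prime ?main_prime. Qed.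

Definition prog_op : finType := (bool * label)%type.
Definition prog_den (o : prog_op) := if o.1 then main o.2 else aux o.2.
Definition prog_num (o : prog_op) := if o.1 then aux o.2 else main o.2.
(** The boolean equality reverses the sign of the label when the trade goes backward. *)
Definition prog_heading (o : prog_op) : direction n :=
  (o.1 == o.2.1, lift ord0 o.2.2).

(** Mode [None] passes over a number, [Some true] trades forward, [Some false] trades back. *)
Definition mode_at d := if [exists j, aux j %| d] then None else Some true.

Definition prog_rule (s : option bool) (r : nat) : option bool * option prog_op :=
  if (if s == Some true then [pick j | main j %| r] else None) is Some j
  then (Some true, Some (true, j))
  else if (if s then [pick j | aux j %| r] else None) is Some j
  then (Some false, Some (false, j))
  else (mode_at r.+1, None).

Lemma prog_den_gt0 o : 0 < prog_den o.
Proof. by rewrite /prog_den; case: ifP => _; rewrite prime_gt0 ?aux_prime ?main_prime. Qed.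

Lemma prog_num_gt0 o : 0 < prog_num o.
Proof. by rewrite /prog_num; case: ifP => _; rewrite prime_gt0 ?aux_prime ?main_prime. Qed.

Lemma prog_heading_neq0 o : (prog_heading o).2 != ord0.
Proof. by []. Qed.

Lemma aux_modulus j : aux j %| prog_modulus.
Proof. by rewrite /prog_modulus (bigD1 j) //= -mulnA dvdn_mulr. Qed.

Lemma main_modulus j : main j %| prog_modulus.
Proof. by rewrite /prog_modulus (bigD1 j) //= mulnAC dvdn_mull. Qed.

Lemma prog_rule_mod s d : prog_rule s (d %% prog_modulus) = prog_rule s d.
Proof.
rewrite /prog_rule /mode_at.
have -> : [pick j | main j %| d %% prog_modulus] = [pick j | main j %| d].
  by apply: eq_pick => j; rewrite /dvdn modn_dvdm ?main_modulus.
have -> : [pick j | aux j %| d %% prog_modulus] = [pick j | aux j %| d].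
  by apply: eq_pick => j; rewrite /dvdn modn_dvdm ?aux_modulus.
have -> : [exists j, aux j %| (d %% prog_modulus).+1] = [exists j, aux j %| d.+1].
  apply: eq_existsb => j; rewrite /dvdn -addn1 -modnDml modn_dvdm ?aux_modulus //.
  by rewrite modnDml addn1.
by [].
Qed.

Lemma prog_rule_dvd s d s' o : 0 < d ->
  prog_rule s (d %% prog_modulus) = (s', Some o) -> prog_den o %| d.
Proof.
rewrite prog_rule_mod /prog_rule => _; case: ifP => _.
  case: pickP => [j dj [_ <-] //|_]; case: ifP => // _.
  by case: pickP => // j dj [_ <-].
by case: ifP => // _; case: pickP => // j dj [_ <-].
Qed.

Definition program : machine n :=
  @Machine n (option bool) prog_op prog_modulus prog_modulus_gt0 prog_den prog_num
    prog_den_gt0 prog_num_gt0 prog_heading prog_heading_neq0 prog_rule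
    prog_rule_dvd None (erefl _).

Definition point (y : label -> nat) : cell n :=
  [ffun k => ((y (true, k))%:Z - (y (false, k))%:Z)%R].

(** The division-free form of [d] being [N] times the product of all [(aux j / main j) ^ y j]. *)
Definition invariant N (y : label -> nat) d :=
  d * \prod_j main j ^ y j = N * \prod_j aux j ^ y j.

Lemma prod_expS (F y : label -> nat) j :
  \prod_i F i ^ (y i + (i == j)) = (\prod_i F i ^ y i) * F j.
Proof.
rewrite (bigD1 j) //= [in RHS](bigD1 j) //= eqxx addn1 expnSr -!mulnA.
rewrite [in RHS](mulnC _ (F j)); congr (_ * (_ * _)); apply: eq_bigr => i.
by move/negPf->; rewrite addn0.
Qed.

Local Notation nxt := (@mstep n program).

Definition bump y (j : label) : label -> nat := fun i => y i + (i == j).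

Lemma move_point y j :
  move (point y) (prog_heading (true, j)) = point (bump y j).
Proof.
apply/ffunP=> k; rewrite !ffunE /bump /= /fintype.bump /= add1n eqSS.
case: j => b i /=; rewrite !xpair_eqE [k == i]eq_sym.
have -> : (nat_of_ord i == k) = (i == k) by [].
by case: (i == k); case: b; rewrite /= ?addn0; lia.
Qed.

Lemma unmove_point y j :
  move (point (bump y j)) (prog_heading (false, j)) = point y.
Proof.
apply/ffunP=> k; rewrite !ffunE /bump /= /fintype.bump /= add1n eqSS.
case: j => b i /=; rewrite !xpair_eqE [k == i]eq_sym.
have -> : (nat_of_ord i == k) = (i == k) by [].
by case: (i == k); case: b; rewrite /= ?addn0; lia.
Qed.

Lemma main_neq_aux i j : (main i == aux j) = false.
Proof. by rewrite gtn_eqF // aux_lt_main. Qed.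

Lemma aux_dvd_main j y : (aux j %| \prod_i main i ^ y i) = false.
Proof.
rewrite dvdn_prod_exp ?aux_prime //; last exact: main_prime.
by apply/existsP=> -[i]; rewrite eq_sym main_neq_aux.
Qed.

Lemma aux_dvd_prod j y : (aux j %| \prod_i aux i ^ y i) = (0 < y j).
Proof.
rewrite dvdn_prod_exp ?aux_prime //; last exact: aux_prime.
apply/existsP/idP=> [[i /andP[/eqP/aux_inj->]]//|yj].
by exists j; rewrite eqxx.
Qed.

Lemma mstepE s d x : nxt ((s, d, x) : mstate program) =
  let r := prog_rule s d in
  if r.2 is Some o then (r.1, d %/ prog_den o * prog_num o, move x (prog_heading o))
  else (r.1, d.+1, x).
Proof. by rewrite /mstep /= prog_rule_mod. Qed.

(* The exponents y count the trades; they are not stored by the machine. *)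
Lemma forward N d y : 0 < d -> invariant N y d ->
  exists d' y', [/\ reach nxt ((Some true, d, point y) : mstate program)
                            ((Some true, d', point y') : mstate program),
     0 < d', invariant N y' d' & forall j, ~~ (main j %| d')].
Proof.
elim/ltn_ind: d y => d IH y d0 iy.
case E: [pick j | main j %| d] => [j|]; last first.
  exists d, y; split=> // [|j]; first exact: reach_refl.
  by move: E; case: pickP => // /(_ j) ->.
have /dvdnP[q dE] : main j %| d by move: E; case: pickP => // ? ? [<-].
have q0 : 0 < q by case: q dE d0 => // ->.
have ltd : q * aux j < d by rewrite dE ltn_pmul2l ?aux_lt_main.
have [||d' [y' [hr d'0 iy' hd']]] := IH _ ltd (bump y j).
- by rewrite muln_gt0 q0 prime_gt0 ?aux_prime.
- by rewrite /invariant /bump !prod_expS [RHS]mulnA -iy dE; lia.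
exists d', y'; split=> //; apply: reach_step.
rewrite mstepE /prog_rule /= E /= move_point /prog_den /prog_num /= dE mulnK //.
by rewrite prime_gt0 ?main_prime.
Qed.

(** As no [aux j] divides [N], the invariant makes [aux j] divide [d] exactly when [y j] is
    positive, so [d] itself shows which trades remain to be undone. Since [d] grows, the induction
    is on their number. *)
Lemma backward N (s : bool) d y : 0 < N -> 0 < d -> invariant N y d ->
  (forall j, ~~ (aux j %| N)) -> (s -> forall j, ~~ (main j %| d)) ->
  reach nxt ((Some s, d, point y) : mstate program)
    ((mode_at N.+1, N.+1, origin n) : mstate program).
Proof.
move=> N0 + + auxN; have [b] := ubnP (\sum_i y i).
elim: b s d y => // b IH s d y yb d0 iy sd; apply: reach_step.
have noW j : aux j %| d = (0 < y j).
  rewrite -(aux_dvd_prod j y); have := congr1 (dvdn (aux j)) iy.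
  by rewrite !Euclid_dvdM ?aux_prime // aux_dvd_main (negPf (auxN j)) orbF.
rewrite mstepE /prog_rule.
have -> : (if Some s == Some true then [pick j | main j %| d] else None) = None.
  by case: s sd => // sd; case: pickP => // j; rewrite (negPf (sd isT j)).
rewrite /=; case: pickP => [j dj|nd] /=; last first.
  have y0 i : y i = 0 by apply/eqP; rewrite -leqn0 leqNgt -noW nd.
  have -> : d = N.
    by move: iy; rewrite /invariant !big1 ?muln1 // => i _; rewrite y0.
  have -> : point y = origin n by apply/ffunP=> k; rewrite !ffunE !y0 subrr.
  exact: reach_refl.
have yj : 0 < y j by rewrite -noW.
pose z i := y i - (i == j).
have yE : y =1 bump z j by move=> i; rewrite /bump /z; case: eqP => [->|_] /=; lia.
have /dvdnP[q dE] := dj.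
have q0 : 0 < q by case: q dE d0 => // ->.
have -> : point y = point (bump z j) by apply/ffunP=> k; rewrite !ffunE !yE.
rewrite unmove_point /prog_den /prog_num /= dE mulnK ?prime_gt0 ?aux_prime //.
apply: IH => //.
- have : \sum_i y i = \sum_i z i + \sum_i (i == j) by rewrite -big_split; apply: eq_bigr.
  rewrite (bigD1 j (F := fun i => nat_of_bool (i == j))) //= eqxx.
  move=> e; move: yb; rewrite e addnCA add1n ltnS; apply: leq_ltn_trans; exact: leq_addr.
- by rewrite muln_gt0 q0 prime_gt0 ?main_prime.
- have bE F : \prod_i F i ^ y i = (\prod_i F i ^ z i) * F j.
    by rewrite -prod_expS; apply: eq_bigr => i _; rewrite yE.
  have := iy; rewrite /invariant !bE dE => e.
  have /eqP : aux j * (q * main j * \prod_i main i ^ z i) =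
    aux j * (N * \prod_i aux i ^ z i) by lia.
  by rewrite eqn_pmul2l ?prime_gt0 ?aux_prime // => /eqP.
Qed.

Lemma point0 : origin n = point (fun=> 0).
Proof. by apply/ffunP=> k; rewrite !ffunE. Qed.

Lemma reach_mode_at N : 0 < N ->
  reach nxt (minit program) ((mode_at N, N, origin n) : mstate program).
Proof.
elim: N => // -[|N] IH _.
  by apply: reach_step; rewrite mstepE /=; apply: reach_refl.
apply: reach_trans (IH isT) _; rewrite {1}/mode_at; case: ifPn => [_|/existsPn auxN].
  by apply: reach_step; rewrite mstepE /=; apply: reach_refl.
have [||d [y [hr d0 iy hd]]] := @forward N.+1 N.+1 (fun=> 0); first by [].
  by rewrite /invariant !big1.
by rewrite point0; apply: reach_trans hr _; rewrite -point0; apply: backward iy _ _.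
Qed.

(** The exponents [e] are the positive and negative parts of the coordinates. At the end of the
    forward phase from [N] no [main j] divides [d], so comparing [main j]-valuations in the
    invariant forces [y] to be [e]. *)
Lemma program_visits (c : cell n) : exists k, (iter k nxt (minit program)).2 = c.
Proof.
pose e (j : label) : nat :=
  let v := c j.2 in if j.1 then if (0 <= v)%R then `|v| else 0
                    else if (0 <= v)%R then 0 else `|v|.
have pe : point e = c.
  by apply/ffunP=> k; rewrite ffunE /e /=; case: ifP => ?; lia.
pose N := \prod_j main j ^ e j.
have N0 : 0 < N by apply: prodn_gt0 => j; rewrite expn_gt0 prime_gt0 ?main_prime.
have := reach_mode_at N0; rewrite /mode_at ifF; last first.
  by apply/existsP=> -[j]; rewrite aux_dvd_main.
have [||d [y [hr d0 iy hd]]] := @forward N N (fun=> 0); first by [].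
  by rewrite /invariant !big1.
rewrite point0 => h; have [k kE] := reach_trans h hr.
exists k; rewrite kE /= -pe; suff ye : y =1 e by apply/ffunP=> i; rewrite !ffunE !ye.
move=> j; have := congr1 (logn (main j)) iy.
have pos (F : label -> nat) (z : label -> nat) : (forall i, prime (F i)) -> 0 < \prod_i F i ^ z i.
  by move=> Fp; apply: prodn_gt0 => i; rewrite expn_gt0 prime_gt0.
have logm z : logn (main j) (\prod_i main i ^ z i) = z j.
  rewrite logn_prod_exp ?main_prime //; last exact: main_prime.
  rewrite (bigD1 j) //= eqxx muln1 big1 ?addn0 // => i ij.
  by rewrite (inj_eq main_inj) eq_sym (negPf ij) muln0.
rewrite !lognM ?pos //; try by [exact: main_prime | exact: aux_prime].
rewrite /N !logm.
have -> : logn (main j) d = 0.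
  by apply/eqP; rewrite lognE main_prime d0 (negPf (hd j)).
rewrite logn_prod_exp ?main_prime //; last exact: aux_prime.
by rewrite big1 ?addn0 // => i _; rewrite main_neq_aux muln0.
Qed.

End Program.

Theorem theorem1p1 :
  forall n : nat, (0 < n)%N ->
    (exists P : protocol n 3, sync_explores P) /\
    (exists P : protocol n 4, ssync_explores P).
Proof.
case=> // n _; split.
- have [P hP] := sync_machine (program n.+1); exists P => c.
  by have [k <-] := program_visits c.
- have [P hP] := ssync_machine (program n.+1); exists P => s fs c.
  by have [k <-] := program_visits c; apply: hP.
Qed.
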